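(* Let $q$ be a prime with $q\equiv 3\pmod 4$ and $m\ge 2$ an integer. Then the line graph $L(\Gamma(\mathbb{Z}_{q^m}[i]))$ is pancyclic.
   Context: $\mathbb{Z}_n[i]=\mathbb{Z}[i]/\langle n\rangle=\{a+bi : a,b\in\mathbb{Z}_n\}$ with $i^2=-1$. For a finite commutative ring $R$ with unity, $\Gamma(R)$ has vertex set the nonzero zero-divisors of $R$, distinct $x,y$ adjacent iff $xy=0$. The line graph $L(G)$ has the edges of $G$ as vertices, two being adjacent iff they share an endpoint in $G$. A graph of order $N$ is pancyclic if $N\ge 3$ and it contains a cycle of length $k$ for every $3\le k\le N$. *)

(* Defs.v *)
From HB Require Import structures.
From mathcomp Require Import all_boot all_order all_algebra.
From mathcomp Require Import ring.

Set Implicit Arguments.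
Unset Strict Implicit.
Unset Printing Implicit Defensive.

Import GRing.Theory.
Local Open Scope ring_scope.

(* [Gauss a b] is a + b i. As ['Z_n] is Z/nZ only for n > 1, [gaussZ n] is
   Z_n[i] only for n > 1. *)
Record gaussZ (n : nat) : predArgType := Gauss { gre : 'Z_n; gim : 'Z_n }.

Section GaussRing.
Variable n : nat.
Implicit Types x y z : gaussZ n.

Definition gauss_pair x : 'Z_n * 'Z_n := (gre x, gim x).
Definition pair_gauss (p : 'Z_n * 'Z_n) : gaussZ n := Gauss p.1 p.2.

Lemma gauss_pairK : cancel gauss_pair pair_gauss.
Proof. by case. Qed.

HB.instance Definition _ := Equality.copy (gaussZ n) (can_type gauss_pairK).
HB.instance Definition _ := Choice.copy (gaussZ n) (can_type gauss_pairK).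
HB.instance Definition _ := Countable.copy (gaussZ n) (can_type gauss_pairK).
HB.instance Definition _ : isFinite (gaussZ n) := CanIsFinite gauss_pairK.

Definition gauss0 : gaussZ n := Gauss 0 0.
Definition gauss1 : gaussZ n := Gauss 1 0.
Definition gaussi : gaussZ n := Gauss 0 1.
Definition gauss_opp x : gaussZ n := Gauss (- gre x) (- gim x).
Definition gauss_add x y : gaussZ n := Gauss (gre x + gre y) (gim x + gim y).
Definition gauss_mul x y : gaussZ n :=
  Gauss (gre x * gre y - gim x * gim y) (gre x * gim y + gim x * gre y).

Lemma gauss_addA : associative gauss_add.
Proof. by move=> x y z; rewrite /gauss_add /= !addrA. Qed.

Lemma gauss_addC : commutative gauss_add.
Proof. by move=> x y; congr Gauss; apply: addrC. Qed.

Lemma gauss_add0 : left_id gauss0 gauss_add.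
Proof. by case=> a b; rewrite /gauss_add /= !add0r. Qed.

Lemma gauss_addN : left_inverse gauss0 gauss_opp gauss_add.
Proof. by case=> a b; rewrite /gauss_add /= !addNr. Qed.

HB.instance Definition _ := GRing.isZmodule.Build (gaussZ n)
  gauss_addA gauss_addC gauss_add0 gauss_addN.

Lemma gauss_mulA : associative gauss_mul.
Proof. by move=> x y z; congr Gauss => /=; ring. Qed.

Lemma gauss_mulC : commutative gauss_mul.
Proof. by move=> x y; congr Gauss => /=; ring. Qed.

Lemma gauss_mul1 : left_id gauss1 gauss_mul.
Proof. by case=> a b; congr Gauss => /=; ring. Qed.

Lemma gauss_mulD : left_distributive gauss_mul gauss_add.
Proof. by move=> x y z; congr Gauss => /=; ring. Qed.

Lemma gauss_1neq0 : gauss1 != gauss0.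
Proof. by []. Qed.

HB.instance Definition _ := GRing.Zmodule_isComNzRing.Build (gaussZ n)
  gauss_mulA gauss_mulC gauss_mul1 gauss_mulD gauss_1neq0.

Lemma gaussi2 : gaussi * gaussi = -1.
Proof. by congr Gauss => /=; ring. Qed.

End GaussRing.

Record sgraph := SGraph {
  vertex :> finType;
  adj : rel vertex;
  adj_sym : symmetric adj;
  adj_irr : irreflexive adj
}.

Section ZeroDivisorGraph.
Variable R : finComNzRingType.

Definition zero_divisor (x : R) : bool :=
  [exists y : R, (y != 0) && (x * y == 0)].

Definition zd_vertex : finType := {x : R | (x != 0) && zero_divisor x}.

Definition zd_adj : rel zd_vertex :=
  [rel x y | (x != y) && (val x * val y == 0)].

Lemma zd_adj_sym : symmetric zd_adj.
Proof. by move=> x y; rewrite /zd_adj /= eq_sym mulrC. Qed.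

Lemma zd_adj_irr : irreflexive zd_adj.
Proof. by move=> x; rewrite /zd_adj /= eqxx. Qed.

Definition zero_divisor_graph : sgraph := SGraph zd_adj_sym zd_adj_irr.

End ZeroDivisorGraph.

Section LineGraph.
Variable G : sgraph.

Definition is_edge (e : {set G}) : bool :=
  [exists x : G, exists y : G, adj x y && (e == [set x; y])].

Definition line_vertex : finType := {e : {set G} | is_edge e}.

Definition line_adj : rel line_vertex :=
  [rel e f | (e != f) && (val e :&: val f != set0)].

Lemma line_adj_sym : symmetric line_adj.
Proof. by move=> e f; rewrite /line_adj /= eq_sym setIC. Qed.

Lemma line_adj_irr : irreflexive line_adj.
Proof. by move=> e; rewrite /line_adj /= eqxx. Qed.

Definition line_graph : sgraph := SGraph line_adj_sym line_adj_irr.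

End LineGraph.

(* A repetition-free closed walk on k vertices is a k-cycle only for k >= 3. *)
Definition has_cycle (G : sgraph) (k : nat) : Prop :=
  exists2 c : seq G, size c = k & ucycle (@adj G) c.

Definition pancyclic (G : sgraph) : Prop :=
  (3 <= #|G|)%N /\ forall k : nat, (3 <= k <= #|G|)%N -> has_cycle G k.

(* Main.v *)
(** Since q is inert in Z[i], the norm of a zero divisor x of Z_(q^m)[i] is
    divisible by q and hence so is x, because -1 is not a square modulo q;
    therefore q^(m-1) kills x.  So q^(m-1) is adjacent to every other vertex of
    the zero-divisor graph, which has at least four vertices, namely
    +- q^(m-1) and +- q^(m-1) i.

    The line graph of any such graph is pancyclic.  The edges through the
    universal vertex v form a clique of the line graph, which gives the short
    cycles.  A cycle containing this clique but missing the edge xy can be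
    lengthened by xy: either the successor of vx contains x, or the successor
    of vy contains y, and xy can be inserted there; or both successors contain
    v, hence are adjacent, and xy is inserted by a crossing. *)

Require Import Defs.
From mathcomp Require Import all_boot all_order all_algebra.
From mathcomp Require Import finfield ring.

Set Implicit Arguments.
Unset Strict Implicit.
Unset Printing Implicit Defensive.

Import GRing.Theory.

Section CycleInsertion.
Variables (T : eqType) (r : rel T).
Implicit Types (a b e : T) (c s : seq T).

Lemma next_rot_head c i a s : uniq c -> rot i c = a :: s ->
  next c a = head a s.
Proof.
by move=> Uc rotE; rewrite -(next_rot i Uc) rotE; case: s {rotE} => [|b s] /=;
  rewrite eqxx.
Qed.

Lemma path_head a b s z : r a (head z s) -> path r b (rcons s z) ->
  path r a (rcons s z).
Proof. by case: s => [|g s] /= -> // /andP[]. Qed.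

Lemma cycle_clique c : uniq c -> 1 < size c ->
  {in c &, forall a b, a != b -> r a b} -> cycle r c.
Proof.
case: c => [|a [|b s]] // Uc _ clique_c.
have c_path : sorted r [:: a, b & s].
  apply: pairwise_sorted; move: Uc; rewrite uniq_pairwise.
  by apply: (sub_in_pairwise _ (allss _)).
rewrite /cycle rcons_path; apply/andP; split=> //=.
apply: clique_c; rewrite ?mem_head //; first by rewrite inE mem_last orbT.
by apply: contraTneq Uc => <-; rewrite cons_uniq mem_last.
Qed.

Lemma cycle_insert_next c a e : uniq c -> cycle r c -> a \in c ->
  r a e -> r e (next c a) -> exists2 c', cycle r c' & perm_eq c' (e :: c).
Proof.
move=> Uc cyc_c /rot_to[i s rotE] ae; rewrite (next_rot_head Uc rotE) => es.
move: cyc_c; rewrite -(rot_cycle i) rotE => /= cyc_as.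
exists [:: a, e & s]; first by rewrite /= ae (path_head es cyc_as).
by rewrite (perm_catCA [:: a] [:: e]) /= perm_cons -rotE perm_rot.
Qed.

(* With c = a s1 b s2, reversing s1 gives a e b (rev s1) s2; the two arcs are
   then joined by an edge from the successor of a to the successor of b. *)
Lemma cycle_insert_crossing c a b e : symmetric r -> uniq c -> cycle r c ->
    a \in c -> b \in c -> a != b ->
    r a e -> r e b -> r (next c a) (next c b) ->
  exists2 c', cycle r c' & perm_eq c' (e :: c).
Proof.
move=> r_sym Uc cyc_c ac bc aDb ae eb.
have [i s1 s2 _ _ rot_a] := rot_to_arc Uc ac bc aDb.
rewrite (next_rot_head Uc rot_a).
have rot_b : rot (size (a :: s1)) (rot i c) = b :: s2 ++ a :: s1.
  by rewrite rot_a (rot_size_cat (a :: s1)).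
rewrite -(next_rot i Uc b) (next_rot_head _ rot_b) ?rot_uniq //.
have -> : head a (s1 ++ b :: s2) = last b (rev s1).
  by case: s1 {rot_a rot_b} => [|h s1] //=; rewrite rev_cons last_rcons.
have -> : head b (s2 ++ a :: s1) = head a s2 by case: s2 {rot_a rot_b}.
move=> next_ab; move: cyc_c; rewrite -(rot_cycle i) rot_a -cat_rcons /=.
rewrite rcons_cat cat_path last_rcons => /andP[/path_sorted s1b_path bs2a_path].
have bs1_path : path r b (rev s1).
  rewrite -[path _ _ _]/(sorted r (b :: rev s1)) -rev_rcons rev_sorted.
  by rewrite (eq_sorted (fun x y => r_sym y x)).
exists [:: a, e, b & rev s1 ++ s2].
  by rewrite /= ae eb rcons_cat cat_path bs1_path (path_head next_ab bs2a_path).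
rewrite (perm_catCA [:: a] [:: e]) /= perm_cons perm_sym -(perm_rot i c) rot_a.
rewrite perm_cons (perm_catCA s1 [:: b]) perm_cons perm_cat2r perm_sym.
by rewrite perm_rev.
Qed.

End CycleInsertion.

Section CliqueExtension.
Variables (G : sgraph) (S : {set G}).

Definition clique : Prop := {in S &, forall x y, x != y -> adj x y}.

Lemma ucycle_clique c : clique -> {subset c <= S} -> uniq c -> 1 < size c ->
  ucycle (@adj G) c.
Proof.
move=> cliqueS cS Uc c2; apply/andP; split=> //; apply: cycle_clique => //.
by move=> x y /cS xS /cS yS; apply: cliqueS.
Qed.

Lemma has_cycle_clique k : clique -> 3 <= k <= #|S| -> has_cycle G k.
Proof.
move=> cliqueS /andP[k3 kS].
have szc : size (take k (enum S)) = k by rewrite size_takel // -cardE.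
exists (take k (enum S)) => //; apply: ucycle_clique => //.
- by move=> x /mem_take; rewrite mem_enum.
- by rewrite take_uniq ?enum_uniq.
- by rewrite szc ltnW.
Qed.

Lemma pancyclic_clique_extension : clique -> 3 <= #|S| ->
    (forall c x, ucycle (@adj G) c -> {subset S <= c} -> x \notin c ->
       exists2 c', ucycle (@adj G) c' & perm_eq c' (x :: c)) ->
  pancyclic G.
Proof.
move=> cliqueS S3 extend; split=> [|k /andP[k3 kG]].
  exact: leq_trans S3 (max_card _).
have [kS|/ltnW Sk] := leqP k #|S|.
  by apply: has_cycle_clique; rewrite ?k3.
suff [c [cyc_c _ szc]] : exists c,
    [/\ ucycle (@adj G) c, {subset S <= c} & size c = k] by exists c.
elim: k Sk kG {k3} => [|k IHk]; first by rewrite leqNgt (leq_trans _ S3).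
rewrite leq_eqVlt => /predU1P[<- _|].
  have enumS : {subset enum S <= S} by move=> x; rewrite mem_enum.
  exists (enum S); split=> [|x|]; rewrite ?mem_enum -?cardE //.
  by apply: ucycle_clique; rewrite ?enum_uniq -?cardE 1?ltnW.
rewrite ltnS => Sk kG; have [c [cyc_c Sc szc]] := IHk Sk (ltnW kG).
have [x xc] : exists x, x \notin c.
  apply/existsP; rewrite -negb_forall; apply: contraL kG => /forallP c_full.
  rewrite -leqNgt -szc cardE; apply: uniq_leq_size (enum_uniq _) _ => x _.
  exact: c_full.
have [c' cyc_c' c'E] := extend c x cyc_c Sc xc.
exists c'; split=> // [y /Sc yc|]; last by rewrite (perm_size c'E) /= szc.
by rewrite (perm_mem c'E) inE yc orbT.
Qed.

End CliqueExtension.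

Section LineGraph.
Variable G : sgraph.
Local Notation L := (line_graph G).
Implicit Types (e f : L) (c : seq L) (v x y z : G).

Lemma adj_set2_inj v x y : adj v x -> [set v; x] = [set v; y] -> x = y.
Proof.
move=> vx /setP/(_ x); rewrite !inE eqxx orbT => /esym/orP[]/eqP // xv.
by rewrite xv adj_irr in vx.
Qed.

Lemma is_edge_set2 x y : adj x y -> is_edge [set x; y].
Proof.
by move=> xy; apply/existsP; exists x; apply/existsP; exists y; rewrite xy /=.
Qed.

Definition line_edge x y (xy : adj x y) : L := Sub [set x; y] (is_edge_set2 xy).

Lemma line_edgeP e : exists x y (xy : adj x y), e = line_edge xy.
Proof.
case: e => A edgeA; have /existsP[x /existsP[y /andP[xy /eqP AE]]] := edgeA.
by exists x, y, xy; apply: val_inj.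
Qed.

Lemma line_adjI e f x : e != f -> x \in val e -> x \in val f -> adj e f.
Proof.
move=> eDf xe xf; rewrite /= /line_adj /= eDf; apply/set0Pn; exists x.
by rewrite inE xe.
Qed.

Lemma line_adj_other_end x y (xy : adj x y) f :
  adj (line_edge xy) f -> y \notin val f -> x \in val f.
Proof.
case/andP=> _ /set0Pn[z]; rewrite !inE => /andP[/orP[]/eqP-> //].
by move->.
Qed.

Definition star v : {set L} := [set e : L | v \in val e].

Lemma star_clique v : clique (star v).
Proof. by move=> e f; rewrite !inE => ve vf eDf; apply: line_adjI ve vf. Qed.

Lemma card_star v : #|star v| = #|[set x | adj v x]|.
Proof.
have set2_inj : {in [set x | adj v x] &, injective (fun x => [set v; x])}.
  by move=> x y; rewrite !inE => vx _; apply: adj_set2_inj vx.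
rewrite -(card_imset _ val_inj) -(card_in_imset set2_inj); apply: eq_card => A.
apply/imsetP/imsetP=> [[e + ->]|[x]]; rewrite inE; last first.
  by move=> vx ->; exists (line_edge vx); rewrite // inE set21.
have [x [y [xy ->]]] := line_edgeP e; rewrite !inE => /orP[]/eqP->.
  by exists y; rewrite // inE.
by exists x; [rewrite inE adj_sym | rewrite setUC].
Qed.

Lemma ucycle_insert_triangle v x y (vx : adj v x) (vy : adj v y) (xy : adj x y)
    c : ucycle (@adj L) c ->
    line_edge vx \in c -> line_edge vy \in c -> line_edge xy \notin c ->
  exists2 c', ucycle (@adj L) c' & perm_eq c' (line_edge xy :: c).
Proof.
set e_vx := line_edge vx; set e_vy := line_edge vy; set e := line_edge xy.
move=> /andP[cyc_c Uc] vx_c vy_c ec.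
suff [c' cyc_c' c'E] : exists2 c', cycle (@adj L) c' & perm_eq c' (e :: c).
  by exists c' => //; rewrite /ucycle cyc_c' (perm_uniq c'E) /= ec.
have eDc f : f \in c -> f != e by move=> fc; apply: contraNneq ec => <-.
have xe : x \in val e by rewrite set21.
have ye : y \in val e by rewrite set22.
have vx_e : adj e_vx e by apply: line_adjI xe; rewrite ?eDc ?set22.
have vy_e : adj e_vy e by apply: line_adjI ye; rewrite ?eDc ?set22.
have e_next f z : f \in c -> z \in val e -> z \in val (next c f) ->
    adj e (next c f).
  by move=> fc ze; apply: line_adjI => //; rewrite eq_sym eDc ?mem_next.
have [x_next|xN] := boolP (x \in val (next c e_vx)).
  exact: cycle_insert_next Uc cyc_c vx_c vx_e (e_next _ _ vx_c xe x_next).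
have [y_next|yN] := boolP (y \in val (next c e_vy)).
  exact: cycle_insert_next Uc cyc_c vy_c vy_e (e_next _ _ vy_c ye y_next).
have vxDvy : e_vx != e_vy.
  apply/eqP=> /(congr1 val)/(adj_set2_inj vx) xy_eq.
  by have := xy; rewrite xy_eq adj_irr.
apply: (cycle_insert_crossing (@adj_sym L) Uc cyc_c vx_c vy_c vxDvy vx_e).
  by rewrite adj_sym.
apply: (@line_adjI _ _ v).
- by rewrite (can_eq (prev_next Uc)).
- exact: line_adj_other_end (next_cycle cyc_c vx_c) xN.
- exact: line_adj_other_end (next_cycle cyc_c vy_c) yN.
Qed.

End LineGraph.

Section UniversalVertex.
Variables (G : sgraph) (v : G).

Definition universal : Prop := forall x, x != v -> adj v x.

Lemma card_star_universal : universal -> #|star v| = #|G|.-1.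
Proof.
move=> univ_v; rewrite card_star -(cardC1 v); apply: eq_card => x.
rewrite !inE; have [->|/univ_v->//] := eqVneq x v; exact: adj_irr.
Qed.

Lemma pancyclic_line_universal : universal -> 4 <= #|G| ->
  pancyclic (line_graph G).
Proof.
move=> univ_v G4; apply: (pancyclic_clique_extension (@star_clique _ v)).
  by rewrite card_star_universal //; case: #|G| G4.
move=> c e cyc_c star_c; have [x [y [xy ->]]] := line_edgeP e => ec.
have [xDv yDv] : x != v /\ y != v.
  by split; apply: contraNneq ec => zv; rewrite star_c // inE -zv ?set21 ?set22.
apply: (ucycle_insert_triangle (vx := univ_v x xDv) (vy := univ_v y yDv)) => //;
  by rewrite star_c // inE set21.
Qed.

End UniversalVertex.

Local Open Scope ring_scope.

Section ZeroDivisors.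
Variable R : finComNzRingType.

Lemma universal_zero_divisor (a : R) : a != 0 -> zero_divisor a ->
    (forall x : R, zero_divisor x -> a * x = 0) ->
  exists v : zero_divisor_graph R, universal v.
Proof.
move=> a0 zd_a ann_a.
have a_vertex : (a != 0) && zero_divisor a by rewrite a0.
exists (Sub a a_vertex : zd_vertex R) => x xDa.
have /andP[_ /ann_a ax0] := valP x.
by rewrite /= /zd_adj /= eq_sym xDa ax0 eqxx.
Qed.

Lemma leq_size_zero_divisor_graph (s : seq R) : uniq s ->
    {in s, forall x, (x != 0) && zero_divisor x} ->
  (size s <= #|zero_divisor_graph R|)%N.
Proof.
move=> /card_uniqP<- s_zd; rewrite card_sig.
by apply/subset_leq_card/subsetP => x /s_zd; rewrite inE.
Qed.

End ZeroDivisors.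

Lemma mulrn_card (V : finZmodType) (x : V) : x *+ #|V| = 0.
Proof.
apply: (addrI (\sum_(y : V) y)); rewrite addr0 -sumr_const -big_split /=.
by rewrite [RHS](reindex_inj (addIr x)).
Qed.

Lemma odd_card_two_neq0 (R : finNzRingType) : odd #|R| -> 2%:R != 0 :> R.
Proof.
move=> oddR; apply/eqP => two0; have := mulrn_card (1 : R).
rewrite -(odd_double_half #|R|) oddR -mul2n natrD natrM two0 mul0r addr0.
by apply/eqP/oner_neq0.
Qed.

Lemma sqr_neqN1_3mod4 (F : finFieldType) (z : F) : (#|F| = 3 %[mod 4])%N ->
  z ^+ 2 != -1.
Proof.
move=> F3; apply/eqP => z2.
have cardFE : #|F| = (4 * (#|F| %/ 4) + 3)%N.
  by rewrite {1}(divn_eq #|F| 4) F3 mulnC.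
have two_neq0 : 2%:R != 0 :> F.
  by apply: odd_card_two_neq0; rewrite cardFE oddD oddM.
have : z ^+ #|F| = - z.
  rewrite cardFE exprD exprM (exprM z 2 2) z2 sqrrN !expr1n mul1r.
  by rewrite exprSr z2 mulN1r.
rewrite expf_card => /eqP; rewrite -addr_eq0 -mulr2n -mulr_natl mulf_eq0.
rewrite (negPf two_neq0) => /eqP z0.
by move/eqP: z2; rewrite z0 expr0n eq_sym oppr_eq0 oner_eq0.
Qed.

Lemma sqrD_eq0_3mod4 (F : finFieldType) (a b : F) : (#|F| = 3 %[mod 4])%N ->
  (a ^+ 2 + b ^+ 2 == 0) = (a == 0) && (b == 0).
Proof.
move=> F3; have [->|b0] := eqVneq b 0.
  by rewrite expr0n addr0 expf_eq0 andbT.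
rewrite andbF; apply: contraNF (sqr_neqN1_3mod4 (a / b) F3); rewrite addr_eq0.
by move=> /eqP ab; rewrite exprMn exprVn ab mulNr divff // expf_neq0.
Qed.

Lemma prime_3mod4_dvd_sqrD q a b : prime q -> (q = 3 %[mod 4])%N ->
  (q %| a ^ 2 + b ^ 2)%N = (q %| a)%N && (q %| b)%N.
Proof.
move=> q_pr q3; have Fq3 : (#|'F_q| = 3 %[mod 4])%N by rewrite card_Fp.
by rewrite !(dvdn_pcharf (pchar_Fp q_pr)) natrD !natrX sqrD_eq0_3mod4.
Qed.

Section GaussNorm.
Variable n : nat.
Implicit Types x y : gaussZ n.

Definition gauss_conj x : gaussZ n := Gauss (gre x) (- gim x).
Definition gauss_norm x : 'Z_n := gre x ^+ 2 + gim x ^+ 2.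

Lemma gauss_norm_natr x : gauss_norm x = (gre x ^ 2 + gim x ^ 2)%N%:R.
Proof. by rewrite natrD !natrX !natr_Zp. Qed.

Lemma gauss_eqE (a b c d : 'Z_n) :
  (Gauss a b == Gauss c d) = (a == c) && (b == d).
Proof. by []. Qed.

Lemma gauss_eq0 x : (x == 0) = (gre x == 0) && (gim x == 0).
Proof. by case: x. Qed.

Lemma mul_scalar_gauss_eq0 (a : 'Z_n) x :
  (Gauss a 0 * x == 0) = (a * gre x == 0) && (a * gim x == 0).
Proof. by rewrite gauss_eq0 /= !mul0r subr0 addr0. Qed.

Lemma mul_conj_gauss x : gauss_conj x * x = Gauss (gauss_norm x) 0.
Proof. by congr Gauss; rewrite /gauss_norm /=; ring. Qed.

Lemma zero_divisor_norm_nonunit x : zero_divisor x ->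
  gauss_norm x \isn't a GRing.unit.
Proof.
case/existsP=> y /andP[y0 /eqP xy0]; apply: contra y0 => normU.
have: Gauss (gauss_norm x) 0 * y == 0.
  by rewrite -mul_conj_gauss -mulrA xy0 mulr0.
by rewrite mul_scalar_gauss_eq0 !(mulrI_eq0 _ (mulrI normU)) -gauss_eq0.
Qed.

End GaussNorm.

Lemma Zp_nat_eq0 n k : (1 < n)%N -> (k%:R == 0 :> 'Z_n) = (n %| k)%N.
Proof. by move=> n1; rewrite -val_eqE /= val_Zp_nat. Qed.

Definition socle_gen (q m : nat) : 'Z_(q ^ m) := (q ^ m.-1)%:R.

Section SocleGenerator.
Variables q m : nat.
Hypotheses (q_gt1 : (1 < q)%N) (m_gt0 : (0 < m)%N).

Local Notation t := (socle_gen q m).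

Lemma socle_gen_mul_natr_eq0 k : (t * k%:R == 0) = (q %| k)%N.
Proof.
rewrite -natrM Zp_nat_eq0; last by rewrite -(exp1n m) ltn_exp2r.
rewrite -[in X in (X %| _)%N](prednK m_gt0) expnSr.
by rewrite dvdn_pmul2l // expn_gt0 ltnW.
Qed.

Lemma socle_gen_mul_eq0 (a : 'Z_(q ^ m)) : (t * a == 0) = (q %| a)%N.
Proof. by rewrite -[a in LHS]natr_Zp socle_gen_mul_natr_eq0. Qed.

Lemma socle_gen_neq0 : t != 0.
Proof. by rewrite -[t]mulr1 (socle_gen_mul_natr_eq0 1) dvdn1 gtn_eqF. Qed.

Lemma socle_gen_neq_opp : (2 < q)%N -> t != - t.
Proof.
move=> q_gt2; rewrite -addr_eq0 -mulr2n -(mulr_natr t) socle_gen_mul_natr_eq0.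
by rewrite gtnNdvd.
Qed.

Lemma socle_gen_sqr : (1 < m)%N -> t * t = 0.
Proof.
move=> m_gt1; apply/eqP; rewrite socle_gen_mul_natr_eq0 dvdn_exp //.
by rewrite -ltnS prednK.
Qed.

End SocleGenerator.

Section GaussPrimePower.
Variables q m : nat.
Hypotheses (q_pr : prime q) (q3 : (q = 3 %[mod 4])%N).

Let q_gt1 : (1 < q)%N := prime_gt1 q_pr.

Local Notation R := (gaussZ (q ^ m)).
Local Notation t := (socle_gen q m).

Lemma zero_divisor_gaussE (x : R) : (0 < m)%N ->
  zero_divisor x = (Gauss t 0 * x == 0).
Proof.
move=> m_gt0; apply/idP/idP=> [/zero_divisor_norm_nonunit|tx0].
  rewrite mul_scalar_gauss_eq0 !socle_gen_mul_eq0 // -prime_3mod4_dvd_sqrD //.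
  rewrite gauss_norm_natr unitZpE; last by rewrite -(exp1n m) ltn_exp2r.
  by rewrite coprime_pexpl // prime_coprime // negbK.
apply/existsP; exists (Gauss t 0).
by rewrite gauss_eq0 negb_and socle_gen_neq0 // mulrC.
Qed.

Hypothesis m_gt1 : (1 < m)%N.

Lemma exists_universal_zero_divisor_gauss :
  exists v : zero_divisor_graph R, universal v.
Proof.
have m_gt0 := ltnW m_gt1.
apply: (@universal_zero_divisor _ (Gauss t 0)) => [||x].
- by rewrite gauss_eq0 negb_and socle_gen_neq0.
- rewrite zero_divisor_gaussE // mul_scalar_gauss_eq0 /= mulr0 eqxx andbT.
  by rewrite socle_gen_sqr.
- by rewrite zero_divisor_gaussE // => /eqP.
Qed.

Lemma card_zero_divisor_graph_gauss_ge4 : (4 <= #|zero_divisor_graph R|)%N.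
Proof.
have m_gt0 := ltnW m_gt1.
have q_gt2 : (2 < q)%N by case: q q3 => [|[|[]]].
have tE := (negPf (socle_gen_neq0 q_gt1 m_gt0), socle_gen_sqr q_gt1 m_gt0 m_gt1,
            negPf (socle_gen_neq_opp q_gt1 m_gt0 q_gt2)).
pose s : seq R := [:: Gauss t 0; Gauss (- t) 0; Gauss 0 t; Gauss 0 (- t)].
apply: (@leq_size_zero_divisor_graph _ s); last apply/allP.
  by rewrite /= !inE !gauss_eqE ![0 == _]eq_sym !oppr_eq0 !tE.
rewrite /= !gauss_eq0 !zero_divisor_gaussE // !mul_scalar_gauss_eq0 /=.
by rewrite !mulrN !mulr0 !oppr_eq0 !tE eqxx.
Qed.

End GaussPrimePower.

Local Close Scope ring_scope.

Theorem theorem3p8 (q m : nat) (hq : prime q) (hq4 : q = 3 %[mod 4])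
    (hm : 2 <= m) :
  pancyclic (line_graph (zero_divisor_graph (gaussZ (q ^ m)))).
Proof.
have [v univ_v] := exists_universal_zero_divisor_gauss hq hq4 hm.
apply: pancyclic_line_universal univ_v _.
exact: card_zero_divisor_graph_gauss_ge4.
Qed.
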